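(* Let $n,m,r\ge 1$ be integers, let $A\in\mathbb{R}^{m\times m}$ and $B,C\in\mathbb{R}^{m\times r}$. Assume that $\mathcal{M}_k(BC^T)\neq 0$ for all $k\in\{1,\dots,n\}$. Then the spectral identification problem is feasible, that is, for any two Laplacian matrices $L_1,L_2\in\mathbb{R}^{n\times n}$, setting $$J_1 = I_n\otimes A - L_1\otimes BC^T,\qquad J_2 = I_n\otimes A - L_2\otimes BC^T,$$ one has $$\sigma(J_1)=\sigma(J_2)\iff \sigma(L_1)=\sigma(L_2).$$
   Context: For a square matrix $M$ of size $N$, $\sigma(M)$ denotes its spectrum, i.e. the collection of its $N$ complex eigenvalues counted with algebraic multiplicity (equality of spectra means equality as multisets). The $k$-th spectral moment of an $N\times N$ matrix $M$ is $\mathcal{M}_k(M)=\frac1N\operatorname{tr}(M^k)$, i.e. the average of the $k$-th powers of its eigenvalues; in particular $\mathcal{M}_k(BC^T)=\frac1m\operatorname{tr}\big((BC^T)^k\big)$. A Laplacian matrix is a matrix of the form $L=D-W$, where $W\in\mathbb{R}^{n\times n}$ is the (weighted) adjacency matrix of a network with $n$ nodes and $D=\operatorname{diag}(d_1,\dots,d_n)$ with $d_i=\sum_{k=1}^n W_{ik}$. $I_n$ is the $n\times n$ identity matrix and $\otimes$ is the Kronecker product. *)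

(* Defs.v *)
From mathcomp Require Import all_boot all_order all_algebra.
From mathcomp Require Import finmap multiset.
From mathcomp Require Import reals.
From mathcomp Require Export complex mxtens.

Set Implicit Arguments.
Unset Strict Implicit.
Unset Printing Implicit Defensive.

Import Order.TTheory GRing.Theory Num.Theory.

Local Open Scope ring_scope.
Local Open Scope complex_scope.
Local Open Scope mset_scope.

(* The eigenvalues are the roots in R[i] of the characteristic polynomial of M,
   repeated as many times as they occur in its factorization into linear
   factors, i.e., with their algebraic multiplicity; see [char_poly_spectrum]. *)
Definition spectrum (R : realType) (N : nat) (M : 'M[R]_N) : {mset R[i]} :=
  seq_mset (sval (closed_field_poly_normal
                    (char_poly (map_mx (real_complex R) M)))).

Lemma char_poly_spectrum (R : realType) (N : nat) (M : 'M[R]_N) :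
  char_poly (map_mx (real_complex R) M) =
    \prod_(z <- spectrum M : seq R[i]) ('X - z%:P).
Proof.
rewrite /spectrum; case: closed_field_poly_normal => s /= ->.
rewrite (monicP (char_poly_monic _)) scale1r.
by apply: perm_big; rewrite perm_sym perm_eq_seq_mset.
Qed.

Definition spectral_moment (R : realType) (N : nat) (k : nat) (M : 'M[R]_N) : R :=
  N%:R^-1 * \tr (M ^+ k).

(* The network is directed, and its weights are arbitrary real numbers. *)
Definition laplacian (R : realType) (n : nat) (W : 'M[R]_n) : 'M[R]_n :=
  diag_mx (\row_i \sum_(k < n) W i k) - W.

Definition is_laplacian (R : realType) (n : nat) (L : 'M[R]_n) : Prop :=
  exists W : 'M[R]_n, L = laplacian W.

(* Main.v *)
(** Over R[i] both spectra are determined by the traces of the powers. Expanding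
    the power, tr (J ^ k) is a linear combination of the tr (L ^ j), j <= k, whose
    coefficients depend only on A and K = B C^T, and the coefficient of tr (L ^ k)
    is (-1)^k tr (K ^ k). Hence the traces of L determine those of J, and
    conversely by induction on k, since tr (K ^ k) does not vanish for
    1 <= k <= n. By Newton, the first n traces suffice to recover the n eigenvalues
    of L. *)
Require Import Defs.
From mathcomp Require Import all_boot all_order all_algebra.
From mathcomp Require Import finmap multiset.
From mathcomp Require Import reals.
From mathcomp Require Import spectral.

Import Order.TTheory GRing.Theory Num.Theory.

Local Open Scope ring_scope.

(* Newton's identities: the logarithmic derivative of the product is the sum of the
   1 / (X - x), whose expansion in 1 / X has the power sums as coefficients. *)
Lemma Xn_deriv_prod_XsubC (R : comNzRingType) (s : seq R) (N : nat) :
  exists2 r : {poly R}, (size r <= size s)%N &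
    'X^(N.+1) * (\prod_(x <- s) ('X - x%:P))^`() =
    \prod_(x <- s) ('X - x%:P) *
      \sum_(k < N.+1) (\sum_(x <- s) x ^+ k) *: 'X^(N - k) + r.
Proof.
elim: s => [|x s [r size_r IHs]].
  exists 0; first by rewrite size_poly0.
  rewrite !big_nil derivE mulr0 mul1r addr0 big1 // => k _.
  by rewrite big_nil scale0r.
(* Since X^(N+1) = x^(N+1) + (X - x) * sum_k x^k X^(N-k), the new factor leaves x^(N+1) times the
   old product, while the old remainder is multiplied by X - x. *)
exists ((x ^+ N.+1)%:P * \prod_(y <- s) ('X - y%:P) + ('X - x%:P) * r).
  apply: (leq_trans (size_polyD _ _)); rewrite geq_max; apply/andP; split.
    by rewrite mul_polyC (leq_trans (size_scale_leq _ _)) // size_prod_XsubC.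
  by apply: (leq_trans (size_polyMleq _ _)); rewrite size_XsubC /= add0n.
rewrite !big_cons derivM derivXsubC mul1r mulrDr.
rewrite (mulrCA 'X^_) IHs.
under [X in _ = _ * X + _]eq_bigr => k _ do rewrite big_cons scalerDl.
rewrite big_split /=.
have := subrXX 'X x%:P N.+1; rewrite -polyC_exp => /eqP.
under [X in _ == _ * X]eq_bigr => k _ do rewrite -polyC_exp mulrC mul_polyC.
rewrite subr_eq => /eqP ->.
set q := \prod_(_ <- _) _; set T := \sum_(k < _) _; set U := \sum_(k < _) _.
by rewrite mulrDl !mulrDr !mulrA (mulrAC _ T) -!addrA; congr (_ + _);
  rewrite addrCA.
Qed.

(** For [N := n] the identity above involves only power sums of exponent at most n, so the same [T]
    serves both lists. The difference of the products then satisfies the same relation, which forces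
    degree n unless it is zero; but the leading terms of two monic polynomials cancel. *)
Lemma eq_power_sums_prod_XsubC (F : numFieldType) (s t : seq F) :
  size s = size t ->
  (forall k, (1 <= k <= size s)%N ->
     \sum_(x <- s) x ^+ k = \sum_(x <- t) x ^+ k) ->
  \prod_(x <- s) ('X - x%:P) = \prod_(x <- t) ('X - x%:P).
Proof.
move=> eq_size eq_sum; set n := size s.
have [rs size_rs] := Xn_deriv_prod_XsubC _ s n.
have [rt size_rt] := Xn_deriv_prod_XsubC _ t n.
set p := \prod_(x <- s) _; set q := \prod_(x <- t) _.
have -> : \sum_(k < n.+1) (\sum_(x <- t) x ^+ k) *: 'X^(n - k) =
          \sum_(k < n.+1) (\sum_(x <- s) x ^+ k) *: 'X^(n - k) :> {poly F}.
  (* The power sum of exponent 0 is the length of the list. *)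
  apply: eq_bigr => -[[|k] /= lt_k] _; last by rewrite eq_sum.
  by rewrite !big_const_seq !count_predT eq_size.
set T := \sum_(k < _) _ => eq_q eq_p.
have coefT_n : T`_n = n%:R.
  rewrite /T big_ord_recl coefD coefZ subn0 coefXn eqxx mulr1.
  rewrite big_const_seq count_predT iter_addr addr0 coef_sum big1 ?addr0 //.
  by move=> k _; rewrite coefZ coefXn gtn_eqF ?mulr0 // ltn_subrL (leq_ltn_trans _ (ltn_ord k)).
have size_T : (size T <= n.+1)%N.
  apply: leq_trans (size_sum _ _ _) _; apply/bigmax_leqP => k _; apply: leq_trans (size_scale_leq _ _) _.
  by rewrite size_polyXn ltnS leq_subr.
apply/eqP; rewrite -subr_eq0; apply/negPn/negP => d_neq0.
(* With d of degree e < n, comparing the coefficients of degree n + e in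
   X^(n+1) d' = d T + (rs - rt) gives e d_e = n d_e. *)
set d := p - q in d_neq0; set e := (size d).-1.
have size_d : size d = e.+1 by rewrite prednK // lt0n size_poly_eq0.
have lt_e_n : (e < n)%N.
  rewrite -size_d; apply/leq_sizeP => j; rewrite leq_eqVlt coefB.
  have size_p : size p = n.+1 by rewrite size_prod_XsubC.
  have size_q : size q = n.+1 by rewrite size_prod_XsubC -eq_size.
  case/predU1P => [<-|lt_nj]; last by rewrite !nth_default ?subr0 ?size_p ?size_q.
  have /monicP := monic_prod_XsubC s xpredT id; rewrite lead_coefE -/p size_p => ->.
  have /monicP := monic_prod_XsubC t xpredT id; rewrite lead_coefE -/q size_q => ->.
  by rewrite subrr.
have eq_d : 'X^(n.+1) * d^`() = d * T + (rs - rt).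
  by rewrite derivB mulrBr eq_p eq_q mulrBl opprD addrACA.
have /(congr1 (fun f : {poly F} => f`_(n + e))) := eq_d.
have size_r : (size (rs - rt)%R <= n)%N.
  by apply: leq_trans (size_polyD _ _) _; rewrite size_polyN geq_max size_rs /n eq_size.
rewrite coefD [(rs - rt)%R`__]nth_default ?(leq_trans size_r) ?leq_addr //.
have -> : ('X^(n.+1) * d^`())`_(n + e) = e%:R * d`_e.
  (* For e = 0 the degree n + e is below n + 1, so both sides are 0. *)
  rewrite coefXnM ltnS; case: (posnP e) => [->|e_gt0].
    by rewrite addn0 leqnn mul0r.
  rewrite leqNgt -addn1 leq_add2l e_gt0 /= coef_deriv.
  by rewrite subnDl subn1 prednK // mulr_natl.
have -> : (d * T)`_(n + e) = d`_e * n%:R.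
  (* Only i = e survives in the convolution: a smaller i calls for a coefficient of [T] beyond
     degree n, a larger one for a coefficient of [d] beyond degree e. *)
  rewrite coefM (bigD1 (Ordinal (leq_addl n e : e < (n + e).+1)%N)) //= addnK coefT_n.
  rewrite big1 ?addr0 // => -[i /= lt_i]; rewrite -val_eqE /= neq_ltn.
  case/orP=> [lt_ie|lt_ei].
    by rewrite [T`__]nth_default ?mulr0 // (leq_trans size_T) // ltn_subRL addnC ltn_add2l.
  by rewrite nth_default ?mul0r // size_d.
rewrite addr0 mulrC; have d_e_neq0 : d`_e != 0 by rewrite -lead_coefE lead_coef_eq0.
by move=> /(mulfI d_e_neq0)/eqP; rewrite eqr_nat ltn_eqF.
Qed.

(** The number of occurrences of [x] in a list is its multiplicity as a root of the product. *)
Lemma perm_eq_prod_XsubC (F : fieldType) (s t : seq F) :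
  \prod_(x <- s) ('X - x%:P) = \prod_(x <- t) ('X - x%:P) -> perm_eq s t.
Proof.
move=> eq_st; rewrite /perm_eq; apply/allP => x _ /=.
by rewrite -!mu_prod_XsubC eq_st.
Qed.

Lemma trig_mxM (R : pzRingType) (n : nat) (T U : 'M[R]_n) :
  is_trig_mx T -> is_trig_mx U ->
  is_trig_mx (T *m U) /\ forall i, (T *m U) i i = T i i * U i i.
Proof.
move=> /is_trig_mxP trT /is_trig_mxP trU; split=> [|i].
  apply/is_trig_mxP => i j lt_ij; rewrite mxE big1 // => k _.
  have [lt_ik|le_ki] := ltnP i k; first by rewrite trT // mul0r.
  by rewrite trU ?mulr0 // (leq_ltn_trans le_ki).
rewrite mxE (bigD1 i) //= big1 ?addr0 // => k neq_ki.
have [lt_ik|lt_ki|/val_inj eq_ik] := ltngtP i k; first by rewrite trT // mul0r.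
  by rewrite trU ?mulr0.
by rewrite eq_ik eqxx in neq_ki.
Qed.

Lemma trig_mxX (R : pzRingType) (n : nat) (T : 'M[R]_n) (k : nat) :
  is_trig_mx T -> is_trig_mx (T ^+ k) /\ forall i, (T ^+ k) i i = T i i ^+ k.
Proof.
move=> trT; elim: k => [|k [trTk IHk]].
  by rewrite !expr0; split=> [|i]; rewrite ?scalar_mx_is_trig // mxE eqxx.
rewrite exprS -mulmxE; have [trTS eTS] := trig_mxM _ _ _ _ trT trTk.
by split=> // i; rewrite eTS IHk exprS.
Qed.

(** Over polynomials P (X - M) = (X - T) P; take determinants and cancel the nonzero det P. *)
Lemma char_poly_similar (F : fieldType) (n : nat) (P M T : 'M[F]_n) :
  P \in unitmx -> P *m M = T *m P -> char_poly M = char_poly T.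
Proof.
move=> uP eq_PM; pose cP := map_mx polyC P.
have cP_neq0 : \det cP != 0 by rewrite det_map_mx polyC_eq0 -unitfE -unitmxE.
apply: (mulfI cP_neq0); rewrite [RHS]mulrC /char_poly -!det_mulmx /char_poly_mx.
by rewrite mulmxBr mulmxBl scalar_mxC -!map_mxM eq_PM.
Qed.

(** [s] is the diagonal of a Schur triangular form of [M]; powers of a triangular matrix have the
    powers of its diagonal entries on the diagonal. *)
Lemma char_poly_power_sums (C : numClosedFieldType) (n : nat) (M : 'M[C]_n) :
  exists s : seq C, [/\ size s = n, char_poly M = \prod_(x <- s) ('X - x%:P) &
    forall k, \tr (M ^+ k) = \sum_(x <- s) x ^+ k].
Proof.
have [n0|n_gt0] := posnP n.
  subst n; exists [::]; split=> [//||k]; first by rewrite big_nil /char_poly det_mx00.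
  by rewrite /mxtrace big_ord0 big_nil.
have [P /unitarymx_unit uP trP] := Schur M n_gt0.
set T := conjmx P M in trP; have trT : is_trig_mx T := trP.
have eMP : M = invmx P *m T *m P by rewrite /T conjumx // !mulmxA mulVmx // mul1mx mulmxKV.
have eMk k : M ^+ k = invmx P *m T ^+ k *m P.
  elim: k => [|k IHk]; first by rewrite !expr0 mulmx1 mulVmx.
  by rewrite !exprS IHk {1}eMP -!mulmxE !mulmxA mulmxK.
exists [seq T i i | i <- enum 'I_n]; split.
- by rewrite size_map size_enum_ord.
- rewrite big_map big_enum -char_poly_trig //.
  by apply: (char_poly_similar _ _ P) => //; rewrite /T conjumx // mulmxKV.
- move=> k; rewrite big_map big_enum eMk mxtrace_mulC mulmxA mulmxV // mul1mx.
  by apply: eq_bigr => i _; case: (trig_mxX _ _ _ k trT).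
Qed.

Lemma eq_char_poly_traces (C : numClosedFieldType) (n : nat) (M N : 'M[C]_n) :
  char_poly M = char_poly N -> forall k, \tr (M ^+ k) = \tr (N ^+ k).
Proof.
have [s [_ -> eq_s]] := char_poly_power_sums _ _ M.
have [t [_ -> eq_t]] := char_poly_power_sums _ _ N.
by move=> /perm_eq_prod_XsubC perm_st k; rewrite eq_s eq_t (perm_big _ perm_st).
Qed.

Lemma eq_traces_char_poly (C : numClosedFieldType) (n : nat) (M N : 'M[C]_n) :
  (forall k, (1 <= k <= n)%N -> \tr (M ^+ k) = \tr (N ^+ k)) ->
  char_poly M = char_poly N.
Proof.
have [s [size_s -> eq_s]] := char_poly_power_sums _ _ M.
have [t [size_t -> eq_t]] := char_poly_power_sums _ _ N.
move=> eq_tr; apply: eq_power_sums_prod_XsubC; first by rewrite size_s.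
by move=> k le_k; rewrite -eq_s -eq_t eq_tr // -size_s.
Qed.

Lemma spectrum_char_poly (R : realType) (N : nat) (M1 M2 : 'M[R]_N) :
  spectrum M1 = spectrum M2 <->
  char_poly (map_mx (real_complex R) M1) = char_poly (map_mx (real_complex R) M2).
Proof.
split=> [eq_spec|eq_char]; first by rewrite !char_poly_spectrum eq_spec.
by rewrite /spectrum eq_char.
Qed.

Lemma mxtrace_map_exp (R S : pzRingType) (f : {rmorphism R -> S}) (N k : nat)
  (M : 'M[R]_N) : \tr (map_mx f M ^+ k) = f (\tr (M ^+ k)).
Proof. by rewrite -trace_map_mx rmorphXn. Qed.

Lemma spectrum_traces (R : realType) (N : nat) (M1 M2 : 'M[R]_N) :
  spectrum M1 = spectrum M2 -> forall k, \tr (M1 ^+ k) = \tr (M2 ^+ k).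
Proof.
move=> /spectrum_char_poly/eq_char_poly_traces eq_tr k.
by have := eq_tr k; rewrite !mxtrace_map_exp => /fmorph_inj.
Qed.

Lemma traces_spectrum (R : realType) (N : nat) (M1 M2 : 'M[R]_N) :
  (forall k, (1 <= k <= N)%N -> \tr (M1 ^+ k) = \tr (M2 ^+ k)) ->
  spectrum M1 = spectrum M2.
Proof.
move=> eq_tr; apply/spectrum_char_poly/eq_traces_char_poly => k le_k.
by rewrite !mxtrace_map_exp eq_tr.
Qed.

Lemma mxtrace_tens (R : comPzRingType) (n m : nat) (L : 'M[R]_n) (K : 'M[R]_m) :
  \tr (L *t K) = \tr L * \tr K.
Proof.
rewrite /mxtrace big_distrlr pair_big /= (reindex (@mxtens_index n m)) /=; last first.
  by exists (@mxtens_unindex n m) => x _; rewrite ?mxtens_indexK ?mxtens_unindexK.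
by apply: eq_bigr => -[i j] _; rewrite tensmxE.
Qed.

(** [A] and [K] need not commute, but the left factors 1 and [L] do: S j is (-1)^j times the sum of
    all words with j letters [K] and k - j letters [A]. Choosing [S] before [L] lets two Laplacians
    share it. *)
Lemma tens_sub_exp (R : comPzRingType) (n m k : nat) (A K : 'M[R]_m) :
  exists S : nat -> 'M[R]_m,
    [/\ S k = (-1) ^+ k *: K ^+ k, forall j, (k < j)%N -> S j = 0 &
      forall L : 'M[R]_n,
        (1%:M *t A - L *t K) ^+ k = \sum_(j < k.+1) L ^+ j *t S j].
Proof.
elim: k => [|k [S [Sk S0 IHk]]].
  exists (fun j => if j == 0%N then 1%:M else 0); split=> [||L].
  - by rewrite !expr0 scale1r.
  - by case.
  rewrite big_ord1 !expr0; apply/matrixP => i j.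
  case: (mxtens_indexP i) => i0 i1; case: (mxtens_indexP j) => j0 j1.
  rewrite tensmxE !mxE (can_eq (@mxtens_indexK n m)) xpair_eqE.
  by case: eqP; case: eqP; rewrite ?mulr1 ?mulr0.
have tensDr (L : 'M[R]_n) (U V : 'M[R]_m) : L *t (U - V) = L *t U - L *t V.
  by apply/matrixP => i j; rewrite !mxE mulrBr.
(* Words of length k + 1 are sorted by their first letter. *)
exists (fun j => A * S j - (if j is i.+1 then K * S i else 0)); split=> [|[//|j] lt_kj|L].
- by rewrite S0 // Sk mulr0 sub0r !exprS -!mulmxE -scalemxAr mulN1r scaleNr.
- by rewrite !S0 ?mulr0 ?subr0 // ltnW.
rewrite exprS IHk mulrBl !mulr_sumr.
under [RHS]eq_bigr => j _ do rewrite tensDr.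
rewrite sumrB; congr (_ - _).
  rewrite [RHS]big_ord_recr /= S0 // mulr0 tensmx0 addr0.
  by apply: eq_bigr => j _; rewrite -!mulmxE tensmx_mul mul1mx.
rewrite [RHS]big_ord_recl /= tensmx0 add0r.
by apply: eq_bigr => j _; rewrite -!mulmxE tensmx_mul exprS.
Qed.

Theorem proposition1 (R : realType) (n m r : nat)
    (n_ge1 : (1 <= n)%N) (m_ge1 : (1 <= m)%N) (r_ge1 : (1 <= r)%N)
    (A : 'M[R]_m) (B C : 'M[R]_(m, r))
    (moments_neq0 : forall k : nat, (1 <= k <= n)%N ->
       spectral_moment k (B *m C^T) <> 0) :
  forall L1 L2 : 'M[R]_n, is_laplacian L1 -> is_laplacian L2 ->
    let J1 := 1%:M *t A - L1 *t (B *m C^T) in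
    let J2 := 1%:M *t A - L2 *t (B *m C^T) in
    spectrum J1 = spectrum J2 <-> spectrum L1 = spectrum L2.
Proof.
move=> L1 L2 _ _ /=; set K := B *m C^T in moments_neq0 *.
have trJ k : exists a : nat -> R, a k = (-1) ^+ k * \tr (K ^+ k) /\
    forall L : 'M[R]_n, \tr ((1%:M *t A - L *t K) ^+ k) =
      \sum_(j < k.+1) \tr (L ^+ j) * a j.
  have [S [Sk _ eJ]] := tens_sub_exp _ n _ k A K.
  exists (fun j => \tr (S j)); split=> [|L].
    by rewrite Sk mxtraceZ.
  by rewrite eJ raddf_sum; apply: eq_bigr => j _; rewrite /= mxtrace_tens.
split=> [/spectrum_traces eq_J|/spectrum_traces eq_L]; apply: traces_spectrum => k.
  elim/ltn_ind: k => k IHk /andP[k_ge1 k_le_n].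
  have [a [ak eJ]] := trJ k; have := eq_J k; rewrite !eJ !big_ord_recr /=.
  have -> : \sum_(j < k) \tr (L1 ^+ j) * a j = \sum_(j < k) \tr (L2 ^+ j) * a j.
    (* The induction hypothesis starts at exponent 1; at 0 both traces are that of the identity. *)
    apply: eq_bigr => -[[|j] /= lt_jk] _; first by rewrite !expr0.
    by rewrite IHk // (leq_trans (ltnW lt_jk)).
  have a_neq0 : a k != 0.
    rewrite ak mulf_neq0 ?signr_eq0 //; apply/eqP => trK0.
    by apply: (moments_neq0 k); rewrite ?k_ge1 // /spectral_moment trK0 mulr0.
  by move=> /addrI/(mulIf a_neq0).
(* Here k runs up to the size [n * m] of J; equal spectra give equal traces of L at every exponent,
   also beyond n. *)
move=> _; have [a [_ eJ]] := trJ k; rewrite !eJ.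
by apply: eq_bigr => j _; rewrite eq_L.
Qed.
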